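(* Let $0<\rho<1$, let $m$ be a positive integer, and let $Q^m:\sigma_\rho\to\sigma_\rho$ be the $m$th power operator $Q^m(x)=\{t_n^m\}_{n=1}^\infty$ for $x=\{t_n\}_{n=1}^\infty\in\sigma_\rho$. Then $Q^m$ is Gâteaux differentiable on $\sigma_\rho$, and for every $\bar x=(\bar t_1,\bar t_2,\ldots)\in\sigma_\rho$ its Gâteaux derivative $(Q^m)'(\bar x)$ at $\bar x$ satisfies the following. (i) If $m>1$, then $(Q^m)'(\bar x)=\nabla(Q^m)(\bar x)$ is the infinite diagonal matrix with diagonal entries $m\bar t_1^{\,m-1},m\bar t_2^{\,m-1},\ldots$, i.e. $(Q^m)'(\bar x)(v)=\nabla(Q^m)(\bar x)(v)=\{m\bar t_n^{\,m-1}s_n\}_{n=1}^\infty\in\sigma_\rho$ for every $v=\{s_n\}_{n=1}^\infty\in\sigma_\rho\setminus\{\theta_{\sigma_\rho}\}$. (ii) If $m=1$, then $Q'(\bar x)=\nabla(Q)(\bar x)$ (with $Q=Q^1$) is the infinite identity matrix, i.e. $Q'(\bar x)(v)=v$ for every $v\in\sigma_\rho\setminus\{\theta_{\sigma_\rho}\}$.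
   Context: $\sigma_\rho$ is the real vector space of all real sequences $\{t_n\}_{n=1}^\infty$ with $\sum_{n=1}^\infty|t_n|^\rho<\infty$, with origin $\theta_{\sigma_\rho}$. For $k=1,2,\ldots$ let $\|x\|_{\rho,k}=|t_k|^\rho$ for $x=\{t_n\}_{n=1}^\infty\in\sigma_\rho$. $\sigma_\rho$ carries the topology $\tau_\rho$ induced by the family $\mathbb{F}_{\sigma_\rho}=\{\|\cdot\|_{\rho,k}:k=1,2,\ldots\}$, i.e. the sets $\{x:\max\{p(x-x_0):p\in I\}<\lambda\}$, with $I$ a nonempty finite subset of $\mathbb{F}_{\sigma_\rho}$ and $\lambda>0$, form a base of neighborhoods of $x_0$. $\mathcal{F}_{\sigma_\rho}$ is the collection of nonempty finite subsets of $\mathbb{F}_{\sigma_\rho}$. Gâteaux differentiability: $T:\sigma_\rho\to\sigma_\rho$ is Gâteaux differentiable at $\bar x$ with Gâteaux derivative $T'(\bar x)$ if for every $v\ne\theta_{\sigma_\rho}$ there is $T'(\bar x)(v)\in\sigma_\rho$ such that for every $J\in\mathcal{F}_{\sigma_\rho}$ and $\varepsilon>0$ there is $\delta>0$ such that, for real $t$, $0<|t|<\delta$ implies $\max\left\{q\left(\frac{T(\bar x+tv)-T(\bar x)-tT'(\bar x)(v)}{t}\right):q\in J\right\}<\varepsilon$. Fréchet derivative: $\nabla T(\bar x)=A$ is the assertion that $A:\sigma_\rho\to\sigma_\rho$ is a continuous linear mapping such that for every $J\in\mathcal{F}_{\sigma_\rho}$ and $\varepsilon>0$ there are $I\in\mathcal{F}_{\sigma_\rho}$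 and $\delta>0$ such that for all $u\in\sigma_\rho$: if $\max\{p(u):p\in I\}=0$ then $\max\{q(T(\bar x+u)-T(\bar x)-A(u)):q\in J\}=0$; and if $0<\max\{p(u):p\in I\}<\delta$ then $\max\left\{q\left(\frac{T(\bar x+u)-T(\bar x)-A(u)}{\max\{p(u):p\in I\}}\right):q\in J\right\}<\varepsilon$. *)

(* Defs.v *)
From HB Require Import structures.
From mathcomp Require Import all_boot all_order all_algebra finmap.
From mathcomp Require Import all_classical all_reals all_analysis.
Import Order.TTheory GRing.Theory Num.Theory.
Import numFieldNormedType.Exports.

Set Implicit Arguments.
Unset Strict Implicit.
Unset Printing Implicit Defensive.

Local Open Scope classical_set_scope.
Local Open Scope ring_scope.

Definition rho_summable (R : realType) (rho : R) : {pred nat -> R} :=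
  fun t => `[< (\sum_(0 <= n <oo) (`|t n| `^ rho)%:E < +oo)%E >].

(* Sequences are indexed from 0: the terms t_1, t_2, ... are x 0, x 1, ...  *)
Record sigma (R : realType) (rho : R) (hrho : 0 < rho < 1) := Sigma {
  sigma_val :> nat -> R;
  sigma_valP : sigma_val \in rho_summable rho }.

HB.instance Definition _ (R : realType) (rho : R) (hrho : 0 < rho < 1) :=
  [isSub for @sigma_val R rho hrho].
HB.instance Definition _ (R : realType) (rho : R) (hrho : 0 < rho < 1) :=
  [Choice of sigma hrho by <:].

Lemma powRD_le (R : realType) (rho a b : R) : 0 < rho < 1 ->
  0 <= a -> 0 <= b -> (a + b) `^ rho <= a `^ rho + b `^ rho.
Proof.
move=> /andP[r0 r1] a0 b0.
have [ab0|abN0] := eqVneq (a + b) 0.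
  by rewrite ab0 powR0 ?gt_eqF// addr_ge0// powR_ge0.
have ab : 0 < a + b by rewrite lt_def abN0 addr_ge0.
have key c : 0 <= c -> c <= a + b -> c / (a + b) * (a + b) `^ rho <= c `^ rho.
  move=> c0 cab; have [->|cN0] := eqVneq c 0.
    by rewrite !mul0r powR_ge0.
  have cp : 0 < c by rewrite lt_def cN0.
  have -> : c `^ rho = (c / (a + b)) `^ rho * (a + b) `^ rho.
    rewrite -powRM ?divfK ?(ltW ab)//.
    by rewrite divr_ge0// ltW.
  apply: ler_wpM2r; first exact: powR_ge0.
  apply: ger1_powR; last exact: ltW.
  by rewrite divr_gt0//= ler_pdivrMr// mul1r.
have := lerD (key a a0 _) (key b b0 _).
rewrite -mulrDl -mulrDl mulfV// mul1r; apply; first by rewrite lerDl.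
by rewrite lerDr.
Qed.

Lemma rho_summable_dom (R : realType) (rho C : R) (s t : nat -> R) :
  t \in rho_summable rho ->
  (forall n, `|s n| `^ rho <= C * `|t n| `^ rho) ->
  s \in rho_summable rho.
Proof.
move=> /asboolP ht hst; apply/asboolP.
apply: (@le_lt_trans _ _
  (\sum_(0 <= n <oo) (C%:E * (`|t n| `^ rho)%:E))%E).
  apply: lee_nneseries => [i _ _|n _]; first by rewrite lee_fin powR_ge0.
  by rewrite -EFinM lee_fin.
rewrite nneseriesZl; last by move=> i _; rewrite lee_fin powR_ge0.
have S0 : (0 <= \sum_(0 <= n <oo) (`|t n| `^ rho)%:E)%E.
  by apply: nneseries_ge0 => n _ _; rewrite lee_fin powR_ge0.
move: ht S0; case: (X in (X < _)%E -> _) => [r _ _|//|//].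
by rewrite -EFinM ltry.
Qed.

Lemma rho_summable_submod (R : realType) (rho : R) : 0 < rho < 1 ->
  GRing.subsemimod_closed (rho_summable rho).
Proof.
move=> hrho; have /andP[r0 r1] := hrho; split; first split.
- apply/asboolP; rewrite eseries0// => i _ _.
  by rewrite normr0 powR0 ?gt_eqF.
- move=> s t /asboolP hs /asboolP ht; apply/asboolP.
  apply: (@le_lt_trans _ _
    (\sum_(0 <= n <oo) ((`|s n| `^ rho)%:E + (`|t n| `^ rho)%:E))%E).
    apply: lee_nneseries => [i _ _|n _]; first by rewrite lee_fin powR_ge0.
    rewrite -EFinD lee_fin; apply: le_trans (powRD_le hrho _ _) => //.
    apply: ge0_ler_powR; rewrite ?nnegrE ?addr_ge0// ?(ltW r0)//.
    exact: ler_normD.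
  rewrite nneseriesD; [|by move=> *; rewrite lee_fin powR_ge0..].
  exact: lte_add_pinfty.
- move=> a t ht; apply: (rho_summable_dom (C := `|a| `^ rho) ht) => n.
  by rewrite -powRM// -normrM.
Qed.

HB.instance Definition _ (R : realType) (rho : R) (hrho : 0 < rho < 1) :=
  GRing.SubChoice_isSubLmodule.Build R (nat -> R) (rho_summable rho)
    (sigma hrho) (rho_summable_submod hrho).

Section Topology.
Variables (R : realType) (rho : R) (hrho : 0 < rho < 1).
Local Notation sigma := (sigma hrho).

Definition seminorm (k : nat) (x : sigma) : R := `|x k| `^ rho.

Definition seminorms : set (sigma -> R) := range seminorm.

Definition finite_family (I : {fset (sigma -> R)}) : Prop :=
  I != fset0 /\ [set` I] `<=` seminorms.

(* The seminorms are nonnegative, so for a nonempty I the default value 0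
   does not affect the maximum. *)
Definition max_family (I : {fset (sigma -> R)}) (x : sigma) : R :=
  \big[Num.max/0]_(p <- I) p x.

Definition sigma_nbhs (x0 : sigma) : set (set sigma) :=
  [set U | exists (I : {fset (sigma -> R)}) (lambda : R),
    [/\ finite_family I, 0 < lambda &
        [set x | max_family I (x - x0) < lambda] `<=` U]].

Lemma max_family_ge I x p : p \in I -> p x <= max_family I x.
Proof. by move=> pI; exact: (@le_bigmax_seq _ _ _ _ 0 p xpredT (fun p => p x)). Qed.

Lemma max_family_ltP (I : {fset (sigma -> R)}) x e : 0 < e ->
  max_family I x < e <-> forall p, p \in I -> p x < e.
Proof.
move=> e0; rewrite /max_family; split.
  by move=> h p pI; apply: le_lt_trans h; exact: max_family_ge.
by move=> h; rewrite big_seq; apply: bigmax_lt.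
Qed.

Lemma seminorm_subadd k x y : seminorm k (x + y) <= seminorm k x + seminorm k y.
Proof.
have /andP[r0 r1] := hrho.
apply: le_trans (powRD_le hrho _ _) => //.
apply: ge0_ler_powR; rewrite ?nnegrE ?addr_ge0// ?(ltW r0)//.
exact: ler_normD.
Qed.

Lemma max_family0 I : finite_family I -> max_family I 0 = 0.
Proof.
move=> [_ hI]; rewrite /max_family big_seq; apply: big1_idem; first exact: maxxx.
move=> p pI; have [k _ <-] := hI _ pI.
have /andP[r0 _] := hrho.
by rewrite /seminorm /= normr0 powR0// gt_eqF.
Qed.

Lemma max_family_subadd I x y : finite_family I ->
  max_family I (x + y) <= max_family I x + max_family I y.
Proof.
move=> [_ hI].
have ge0 z : 0 <= max_family I z by exact: bigmax_ge_id.
rewrite {1}/max_family big_seq; apply: bigmax_le; first exact: addr_ge0.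
move=> p pI; apply: le_trans (lerD (max_family_ge x pI) (max_family_ge y pI)).
by have [k _ <-] := hI _ pI; exact: seminorm_subadd.
Qed.

HB.instance Definition _ := hasNbhs.Build sigma sigma_nbhs.

Lemma sigma_nbhs_filter (x : sigma) : ProperFilter (nbhs x).
Proof.
have mem I e : finite_family I -> 0 < e -> max_family I (x - x) < e.
  by move=> hI e0; rewrite subrr max_family0.
apply: Build_ProperFilter_ex.
  by move=> A [I [e [hI e0 hA]]]; exists x; apply: hA; exact: mem.
split.
- exists [fset seminorm 0]%fset, 1; split => //; split.
    by apply/fset0Pn; exists (seminorm 0); rewrite inE.
  by move=> p /=; rewrite inE => /eqP ->; exists 0%N.
- move=> A B [I [e [[I0 hI] e0 hA]]] [J [f [[J0 hJ] f0 hB]]].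
  exists (I `|` J)%fset, (Num.min e f); split; last first.
  + move=> y /=; rewrite max_family_ltP ?lt_min ?e0//= => h; split.
      apply: hA => /=; apply/max_family_ltP => // p pI.
      by have := h p; rewrite inE pI => /(_ isT); rewrite lt_min => /andP[].
    apply: hB => /=; apply/max_family_ltP => // p pI.
    by have := h p; rewrite inE pI orbT => /(_ isT); rewrite lt_min => /andP[].
  + by rewrite lt_min e0.
  split.
    by have /fset0Pn[p pI] := I0; apply/fset0Pn; exists p; rewrite inE pI.
  by move=> p /=; rewrite inE => /orP[/hI|/hJ].
- move=> A B AB [I [e [hI e0 hA]]]; exists I, e; split => //.
  exact: subset_trans AB.
Qed.

Lemma sigma_nbhs_singleton (x : sigma) (A : set sigma) : nbhs x A -> A x.
Proof.
by move=> [I [e [hI e0 hA]]]; apply: hA; rewrite /= subrr max_family0.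
Qed.

Lemma sigma_nbhs_nbhs (x : sigma) (A : set sigma) :
  nbhs x A -> nbhs x (nbhs^~ A).
Proof.
move=> [I [e [hI e0 hA]]]; exists I, e; split => // y /= hy.
exists I, (e - max_family I (y - x)); split; rewrite ?subr_gt0//.
move=> z /= hz; apply: hA => /=.
rewrite -(subrKA y z (- x)).
by apply: le_lt_trans (max_family_subadd _ _ hI) _; rewrite -ltrBrDr.
Qed.

HB.instance Definition _ := Nbhs_isNbhsTopological.Build sigma
  sigma_nbhs_filter sigma_nbhs_singleton sigma_nbhs_nbhs.

(* w is a value of the Gateaux derivative of T at x in the direction v. *)
Definition is_gateaux_value (T : sigma -> sigma) (x v w : sigma) : Prop :=
  forall (J : {fset (sigma -> R)}) (eps : R), finite_family J -> 0 < eps ->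
  exists2 delta : R, 0 < delta &
    forall t : R, 0 < `|t| < delta ->
      max_family J (t^-1 *: (T (x + t *: v) - T x - t *: w)) < eps.

Definition gateaux_differentiable (T : sigma -> sigma) (x : sigma) : Prop :=
  forall v : sigma, v != 0 -> exists w : sigma, is_gateaux_value T x v w.

(* Meaningful for v != 0 when T is Gateaux differentiable at x. *)
Definition gateaux (T : sigma -> sigma) (x v : sigma) : sigma :=
  xget 0 (is_gateaux_value T x v).

(* A relation and not a function: every seminorm is homogeneous of degree
   rho < 1, so A is in general not determined by T and x. *)
Definition is_frechet (T : sigma -> sigma) (x : sigma) (A : sigma -> sigma)
    : Prop :=
  [/\ linear A, continuous A &
    forall (J : {fset (sigma -> R)}) (eps : R), finite_family J -> 0 < eps ->
    exists (I : {fset (sigma -> R)}) (delta : R),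
      [/\ finite_family I, 0 < delta &
        forall u : sigma,
          (max_family I u = 0 ->
             max_family J (T (x + u) - T x - A u) = 0) /\
          (0 < max_family I u < delta ->
             max_family J
               ((max_family I u)^-1 *: (T (x + u) - T x - A u)) < eps)]].

Lemma rho_summable_exp (m : nat) (x : sigma) : (0 < m)%N ->
  (fun n => x n ^+ m) \in rho_summable rho.
Proof.
case: m => // m _; have hx := sigma_valP x.
have /asboolP := hx.
have : (forall n, (`|x n| `^ rho)%:E <=
    \sum_(0 <= n <oo) (`|x n| `^ rho)%:E)%E.
  move=> n; rewrite (nneseriesD1 (n := n))//.
  by rewrite leeDl// nneseries_ge0// => i _ _; rewrite lee_fin powR_ge0.
case: (X in (X < _)%E) => [S hS _||]; last 2 first.
- by move=> _; rewrite ltxx.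
- by move=> /(_ 0%N); rewrite leeNy_eq.
apply: (rho_summable_dom (C := S ^+ m) hx) => n.
rewrite normrX -powR_mulrn// powRAC powR_mulrn ?powR_ge0// exprSr.
apply: ler_wpM2r; first exact: powR_ge0.
have := hS n; rewrite lee_fin => h; apply: lerXn2r => //.
  by rewrite nnegrE powR_ge0.
by rewrite nnegrE (le_trans (powR_ge0 _ _) h).
Qed.

Definition power_op (m : nat) (hm : (0 < m)%N) (x : sigma) : sigma :=
  Sigma hrho (rho_summable_exp x hm).

End Topology.

(* Main.v *)
(* At each coordinate the remainder r(u) = (a + u)^m - a^m - m a^(m-1) u is
   O(u^2) for |u| <= 1. Gateaux: r(t v_k) / t = O(t), and a finite family of
   seminorms only sees finitely many coordinates k. Frechet: take I = J and put
   M = max_I u; then |u_k|^rho <= M < 1 gives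
   |r(u_k) / M|^rho <= M^(-rho) C^rho |u_k|^(2 rho) <= C^rho M. *)
Require Import Defs.
From mathcomp Require Import all_boot all_order all_algebra finmap.
From mathcomp Require Import all_classical all_reals all_analysis.
From mathcomp Require Import ring.
Import Order.TTheory GRing.Theory Num.Theory.
Import numFieldNormedType.Exports.

Set Implicit Arguments.
Unset Strict Implicit.
Unset Printing Implicit Defensive.

Local Open Scope classical_set_scope.
Local Open Scope ring_scope.

(** Induction on [m]: the remainder satisfies r_{m+1}(u) = (a + u) r_m(u) + m a^(m-1) u^2, and |a +
    u| <= |a| + 1 when |u| <= 1. *)
Lemma exprD_taylor1 (R : realFieldType) (a : R) (m : nat) :
  exists2 C : R, 0 <= C & forall u, `|u| <= 1 ->
    `|(a + u) ^+ m - a ^+ m - m%:R * a ^+ (m - 1) * u| <= C * `|u| ^+ 2.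
Proof.
elim: m => [|m [C C0 IH]].
  by exists 0 => // u _; rewrite !expr0 subrr sub0r !mul0r oppr0 normr0.
exists ((`|a| + 1) * C + `|m%:R * a ^+ (m - 1)|).
  by rewrite addr_ge0// mulr_ge0// addr_ge0.
move=> u u1.
have -> : (a + u) ^+ m.+1 - a ^+ m.+1 - m.+1%:R * a ^+ (m.+1 - 1) * u =
    (a + u) * ((a + u) ^+ m - a ^+ m - m%:R * a ^+ (m - 1) * u)
    + m%:R * a ^+ (m - 1) * u ^+ 2.
  (* The truncated subtraction [m - 1] breaks a * a^(m-1) = a^m at [m = 0], so that case is checked
     apart. *)
  case: m {IH} => [|m]; first by rewrite !expr1 expr0; ring.
  by rewrite !subn1 /= -!natr1 !exprS; ring.
apply: le_trans (ler_normD _ _) _.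
rewrite [leRHS]mulrDl; apply: lerD; rewrite normrM ?normrX//.
rewrite -[leRHS]mulrA; apply: ler_pM => //; last exact: IH.
by rewrite (le_trans (ler_normD _ _))// lerD2l.
Qed.

Lemma rho_summable_bounded (R : realType) (rho : R) (t : nat -> R) :
  t \in rho_summable rho -> exists S, forall n, `|t n| `^ rho <= S.
Proof.
move=> /asboolP ht.
have le_sum n : ((`|t n| `^ rho)%:E <=
    \sum_(0 <= n <oo) (`|t n| `^ rho)%:E)%E.
  rewrite (nneseriesD1 (n := n)) ?leeDl ?nneseries_ge0// => i _ *;
    by rewrite lee_fin powR_ge0.
move: ht le_sum; case: (X in (X < _)%E -> _) => [S _ hS|//|_ /(_ 0%N)//].
by exists S => n; rewrite -lee_fin.
Qed.

(** * Reduction of both derivatives to single coordinates *)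

Section Sigma.
Variables (R : realType) (rho : R) (hrho : 0 < rho < 1).
Local Notation sigma := (sigma hrho).

Let rho_gt0 : 0 < rho. Proof. by case/andP: hrho. Qed.
Let rho_ge0 : 0 <= rho. Proof. exact: ltW. Qed.
Let rho_lt1 : rho < 1. Proof. by case/andP: hrho. Qed.

Lemma sigmaP (x y : sigma) : x =1 y -> x = y.
Proof. by move=> xy; apply: val_inj; apply: funext. Qed.

Lemma sigmaDE (x y : sigma) n : (x + y) n = x n + y n. Proof. by []. Qed.
Lemma sigmaBE (x y : sigma) n : (x - y) n = x n - y n. Proof. by []. Qed.
Lemma sigmaNE (x : sigma) n : (- x) n = - x n. Proof. by []. Qed.
Lemma sigmaZE (a : R) (x : sigma) n : (a *: x) n = a * x n. Proof. by []. Qed.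

Lemma seminormZ k a (x : sigma) :
  seminorm k (a *: x) = `|a| `^ rho * seminorm k x.
Proof. by rewrite /seminorm sigmaZE normrM powRM. Qed.

Lemma seminormN k (x : sigma) : seminorm k (- x) = seminorm k x.
Proof. by rewrite /seminorm sigmaNE normrN. Qed.

Lemma seminorm_eq0 k (x : sigma) : (seminorm k x == 0) = (x k == 0).
Proof.
by rewrite /seminorm powR_eq0 normr_eq0 [rho == 0]gt_eqF ?andbT.
Qed.

Lemma finite_family_seminorm k :
  finite_family [fset (@seminorm R rho hrho k)]%fset.
Proof.
split; first by apply/fset0Pn; exists (seminorm k); rewrite inE.
by move=> p /=; rewrite inE => /eqP ->; exists k.
Qed.


(** A filter is closed under finite intersections, so an eventual estimate may be proved one
    coordinate at a time. *)
Lemma near_finite_family (T : Type) (F : set_system T) (J : {fset sigma -> R})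
    (Q : (sigma -> R) -> T -> Prop) : Filter F -> finite_family J ->
  (forall k, \forall t \near F, Q (seminorm k) t) ->
  \forall t \near F, forall p, p \in J -> Q p t.
Proof.
move=> FF [_ hJ] hQ.
have := @filter_bigI _ _ J Q F FF.
by apply => p /hJ[k _ <-]; exact: hQ.
Qed.

Lemma is_gateaux_valueP (T : sigma -> sigma) (x v w : sigma) :
  is_gateaux_value T x v w <->
  forall k eps, 0 < eps -> \forall t \near 0^',
    seminorm k (t^-1 *: (T (x + t *: v) - T x - t *: w)) < eps.
Proof.
split=> [h k eps e0|h J eps hJ e0].
  have [d d0 hd] := h _ _ (finite_family_seminorm k) e0.
  exists d => //= t; rewrite /ball_ /= sub0r normrN => td t0.
  have := hd t; rewrite normr_gt0 t0 td => /(_ isT) /max_family_ltP; apply => //.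
  by rewrite inE.
have /= [d /= d0 hd] := near_finite_family
  (Q := fun p t => p (t^-1 *: (T (x + t *: v) - T x - t *: w)) < eps)
  (@dnbhs_filter R 0) hJ (fun k => h k eps e0).
exists d => // t; rewrite normr_gt0 => /andP[t0 td].
by apply/max_family_ltP => //; apply: hd => //=; rewrite sub0r normrN.
Qed.

(** The seminorms separate points, so limits are unique. This identifies the value that [xget] picks
    in [gateaux]. *)
Lemma gateaux_value_unique (T : sigma -> sigma) (x v w w' : sigma) :
  is_gateaux_value T x v w -> is_gateaux_value T x v w' -> w = w'.
Proof.
move=> /is_gateaux_valueP hw /is_gateaux_valueP hw'; apply/sigmaP => k.
apply/eqP; rewrite -subr_eq0 -sigmaBE -seminorm_eq0.
rewrite eq_le powR_ge0 andbT; apply/ler_addgt0Pl => e e0; rewrite addr0.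
have e2 : 0 < e / 2 by rewrite divr_gt0.
near (0 : R)^' => t.
have t0 : t != 0 by near: t; exact: nbhs_dnbhs_neq.
(* The increments of [T] cancel, leaving a difference independent of [t]. *)
have -> : w - w' = t^-1 *: (T (x + t *: v) - T x - t *: w')
    + - (t^-1 *: (T (x + t *: v) - T x - t *: w)).
  by apply/sigmaP => n; rewrite !(sigmaDE, sigmaBE, sigmaZE, sigmaNE); field.
apply: (le_trans (seminorm_subadd _ _ _)).
rewrite seminormN (splitr e).
by apply: lerD; apply/ltW; near: t; [exact: hw'|exact: hw].
Unshelve. all: by end_near. Qed.

Lemma gateauxE (T : sigma -> sigma) (x v w : sigma) :
  is_gateaux_value T x v w -> gateaux T x v = w.
Proof.
move=> hw; apply: (@gateaux_value_unique T x v) => //.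
by apply: xgetPex; exists w.
Qed.

(** The scale [M] is kept apart from [u], with only [seminorm k u <= M] known: it is later
    instantiated by the maximum over the whole family, which dominates every coordinate seminorm.
    The last hypothesis covers a zero maximum. *)
Lemma is_frechetP (T A : sigma -> sigma) (x : sigma) :
  linear A -> continuous A ->
  (forall k (eps : R), 0 < eps -> \forall M \near 0^'+, forall u : sigma,
     seminorm k u <= M ->
     seminorm k (M^-1 *: (T (x + u) - T x - A u)) < eps) ->
  (forall k (u : sigma), u k = 0 -> (T (x + u) - T x - A u) k = 0) ->
  is_frechet T x A.
Proof.
move=> lA cA hT hT0; split=> // J eps hJ e0.
have /= [d /= d0 hd] := near_finite_family
  (Q := fun p M => forall u : sigma, p u <= M ->
     p (M^-1 *: (T (x + u) - T x - A u)) < eps)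
  (@at_right_proper_filter R 0) hJ (fun k => hT k eps e0).
exists J, d; split => // u; split => [u0|/andP[M0 Md]]; last first.
  apply/max_family_ltP => // p pJ; apply: hd => //=.
    by rewrite sub0r normrN gtr0_norm.
  exact: max_family_ge.
rewrite /max_family big_seq; apply: big1_idem; first exact: maxxx.
move=> p pJ; have [_ hJs] := hJ; have [k _ kp] := hJs _ pJ.
apply/eqP; rewrite -kp seminorm_eq0; apply/eqP/hT0/eqP.
rewrite -seminorm_eq0 eq_le powR_ge0 andbT -u0 kp; exact: max_family_ge.
Qed.

(** * Diagonal operators with bounded coefficients *)

Section Diagonal.
Variables (d : nat -> R) (D : R).
Hypothesis dD : forall n, `|d n| `^ rho <= D.

Lemma rho_summable_diag (v : sigma) : (fun n => d n * v n) \in rho_summable rho.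
Proof.
apply: (rho_summable_dom (C := D) (sigma_valP v)) => n.
by rewrite normrM powRM// ler_wpM2r// powR_ge0.
Qed.

Definition diag_op (v : sigma) : sigma := Sigma hrho (rho_summable_diag v).

Lemma diag_opE v n : diag_op v n = d n * v n. Proof. by []. Qed.

Lemma diag_op_linear : linear diag_op.
Proof.
by move=> a u v; apply/sigmaP => n; rewrite !(diag_opE, sigmaDE, sigmaZE); ring.
Qed.

Lemma diag_op_continuous : continuous diag_op.
Proof.
have D0 : 0 <= D by rewrite (le_trans (powR_ge0 _ _) (dD 0)).
have D1 : 0 < D + 1 by rewrite ltr_wpDl.
(* A diagonal operator does not mix coordinates, so the same family serves and only the radius
   shrinks; [D + 1] is positive even if [D = 0]. *)
move=> x U [I [e [hI e0 hU]]]; exists I, (e / (D + 1)); split => //.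
  by rewrite divr_gt0.
move=> y /max_family_ltP hy; apply: hU; apply/max_family_ltP => // p pI.
have [_ hIs] := hI; have [k _ kp] := hIs _ pI.
have := hy (divr_gt0 e0 D1) p pI; rewrite -kp ltr_pdivlMr//; apply: le_lt_trans.
rewrite /seminorm !(sigmaBE, diag_opE) -mulrBr normrM powRM// mulrC.
by rewrite ler_wpM2l ?powR_ge0// (le_trans (dD k))// lerDl.
Qed.

End Diagonal.

Lemma power_opE m (hm : (0 < m)%N) (x : sigma) n :
  power_op hm x n = x n ^+ m.
Proof. by []. Qed.

(** * Derivatives of the power operator *)

Section Power.
Variables (m : nat) (hm : (0 < m)%N) (x : sigma).

Lemma power_coef_bounded :
  exists D, forall n, `|m%:R * x n ^+ (m - 1)| `^ rho <= D.
Proof.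
have [S hS] := rho_summable_bounded (sigma_valP x).
(* Exchanging exponents, the rho-th power of |x_n|^(m-1) is (|x_n|^rho)^(m-1), at most
   [S ^+ (m - 1)]. *)
exists (m%:R `^ rho * S ^+ (m - 1)) => n.
rewrite normrM powRM// normr_nat ler_wpM2l ?powR_ge0//.
rewrite normrX -powR_mulrn// powRAC powR_mulrn ?powR_ge0//.
by rewrite lerXn2r ?nnegrE ?powR_ge0// (le_trans (powR_ge0 _ _) (hS n)).
Qed.

(** [A] is specified only through its coordinates, so that the results apply both to [diag_op] and,
    for [m = 1], to [idfun]. *)
Variable A : sigma -> sigma.
Hypothesis AE : forall v n, A v n = m%:R * x n ^+ (m - 1) * v n.

Lemma power_op_gateaux v : is_gateaux_value (power_op hm) x v (A v).
Proof.
apply/is_gateaux_valueP => k eps e0.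
have [C C0 hC] := exprD_taylor1 (x k) m.
set K := C * `|v k| ^+ 2.
have K1 : 0 < K + 1 by rewrite ltr_wpDl// mulr_ge0// exprn_ge0.
have v1 : 0 < `|v k| + 1 by rewrite ltr_wpDl.
(* Taking the rho-th root of [eps] turns the seminorm estimate into one on absolute values. *)
have eta0 : 0 < eps `^ rho^-1 by rewrite powR_gt0.
near=> t.
have t0 : t != 0 by near: t; exact: nbhs_dnbhs_neq.
(* This bound puts t v_k in the range of the Taylor estimate; the next one makes the quotient, at
   most K|t|, smaller than the root of [eps]. *)
have tv : `|t| <= (`|v k| + 1)^-1.
  by near: t; apply: dnbhs0_le; rewrite invr_gt0.
have tK : `|t| < eps `^ rho^-1 / (K + 1).
  by near: t; apply: dnbhs0_lt; rewrite divr_gt0.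
have tv1 : `|t * v k| <= 1.
  rewrite normrM (le_trans (ler_wpM2r _ tv))// mulrC ler_pdivrMr// mul1r.
  by rewrite lerDl.
have -> : eps = (eps `^ rho^-1) `^ rho.
  by rewrite -powRrM mulVf ?gt_eqF// powRr1// ltW.
rewrite /seminorm; apply: gt0_ltr_powR; rewrite ?nnegrE ?(ltW eta0)//.
have -> : (t^-1 *: (power_op hm (x + t *: v) - power_op hm x - t *: A v)) k =
    t^-1 * ((x k + t * v k) ^+ m - x k ^+ m - m%:R * x k ^+ (m - 1) * (t * v k)).
  by rewrite !(sigmaZE, sigmaBE, AE, power_opE, sigmaDE); ring.
rewrite normrM normfV mulrC ltr_pdivrMr ?normr_gt0//.
apply: (le_lt_trans (hC _ tv1)).
rewrite ltr_pdivlMr// in tK.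
rewrite normrM exprMn mulrCA -/K expr2 -mulrA [ltRHS]mulrC ltr_pM2l ?normr_gt0//.
by apply: le_lt_trans tK; rewrite ler_wpM2l// lerDl.
Unshelve. all: by end_near. Qed.

Lemma power_op_frechet : linear A -> continuous A ->
  is_frechet (power_op hm) x A.
Proof.
move=> lA cA; apply: is_frechetP => // k; last first.
  by move=> u u0; rewrite !(sigmaBE, power_opE, sigmaDE) AE u0 addr0 mulr0 !subrr.
move=> eps e0; have [C C0 hC] := exprD_taylor1 (x k) m.
have C1 : 0 < C `^ rho + 1 by rewrite ltr_wpDl ?powR_ge0.
near=> M => u uM.
have M0 : 0 < M by near: M; exact: nbhs_right_gt.
have M1 : M <= 1 by near: M; exact: nbhs_right_le.
have MC : M < eps / (C `^ rho + 1).
  by near: M; apply: nbhs_right_lt; rewrite divr_gt0.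
(* Otherwise 1 < |u_k|^rho <= M, against M <= 1. *)
have u1 : `|u k| <= 1.
  rewrite leNgt; apply/negP => u1.
  have : 1 `^ rho < `|u k| `^ rho by apply: gt0_ltr_powR; rewrite ?nnegrE.
  by rewrite powR1 ltNge (le_trans uM).
rewrite seminormZ.
have -> : seminorm k (power_op hm (x + u) - power_op hm x - A u) =
    `|(x k + u k) ^+ m - x k ^+ m - m%:R * x k ^+ (m - 1) * u k| `^ rho.
  by rewrite /seminorm !(sigmaBE, power_opE, sigmaDE) AE.
(* The scalar comes out as (M^-1)^rho, which is at most M^-1 because M^-1 >= 1 and rho < 1. The
   remainder contributes C^rho (|u_k|^rho)^2 <= C^rho M^2. *)
apply: (@le_lt_trans _ _ (M^-1 * (C `^ rho * M ^+ 2))).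
  apply: ler_pM; rewrite ?powR_ge0//.
    rewrite gtr0_norm ?invr_gt0//; apply: ler1_powR; last exact: ltW.
    by rewrite invr_ge1// unitfE gt_eqF.
  apply: (@le_trans _ _ ((C * `|u k| ^+ 2) `^ rho)).
    apply: ge0_ler_powR; rewrite ?nnegrE ?mulr_ge0// ?exprn_ge0//.
    exact: hC.
  rewrite powRM ?exprn_ge0// ler_wpM2l ?powR_ge0//.
  rewrite -powR_mulrn// powRAC powR_mulrn ?powR_ge0//.
  by rewrite lerXn2r ?nnegrE ?powR_ge0// ltW.
rewrite mulrCA expr2 mulKf ?gt_eqF//.
rewrite ltr_pdivlMr// in MC; apply: le_lt_trans MC.
by rewrite mulrC ler_wpM2l ?(ltW M0)// lerDl.
Unshelve. all: by end_near. Qed.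

End Power.
End Sigma.

Theorem theorem6p7 (R : realType) (rho : R) (hrho : 0 < rho < 1)
    (m : nat) (hm : (0 < m)%N) :
  (forall x : sigma hrho, gateaux_differentiable (power_op hm) x) /\
  forall x : sigma hrho,
    ((1 < m)%N ->
      exists A : sigma hrho -> sigma hrho,
        [/\ is_frechet (power_op hm) x A,
            forall (v : sigma hrho) (n : nat),
              A v n = m%:R * x n ^+ (m - 1) * v n &
            forall v : sigma hrho, v != 0 -> gateaux (power_op hm) x v = A v])
    /\
    (m = 1%N ->
      is_frechet (power_op hm) x idfun /\
      forall v : sigma hrho, v != 0 -> gateaux (power_op hm) x v = v).
Proof.
split=> [x v _|x].
  have [D hD] := power_coef_bounded m x.
  exists (diag_op hD v); exact: power_op_gateaux.
split=> [_|m1].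
  have [D hD] := power_coef_bounded m x.
  exists (diag_op hD); split=> // [|v _].
  - apply: power_op_frechet => //; first exact: diag_op_linear.
    exact: diag_op_continuous.
  - by apply: gateauxE; exact: power_op_gateaux.
(* For [m = 1] the coefficient is x_n^0 = 1, including where x_n = 0. *)
have idE (v : sigma hrho) n : idfun v n = m%:R * x n ^+ (m - 1) * v n.
  by rewrite m1 expr0 !mul1r.
split=> [|v _]; last by apply: gateauxE; exact: (power_op_gateaux hm idE).
apply: power_op_frechet => //; by move=> y; exact: cvg_id.
Qed.
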